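(* Let $d\ge 1$ and let $\{\eta(x):x\in\mathbb{Z}^d\}$ be i.i.d. random variables with values in $\{0,1,2,\dots\}$ and law $\nu$ (product measure). Suppose that for some $0<\delta<d$ and all $n$ large enough, \[ \mathbf{P}[\eta(x)\ge n]\ge(\log n)^{-\delta}. \] Let $\mathfrak{D}=\{x\in\mathbb{R}^d: |x^{(1)}|+\dots+|x^{(d)}|\le 1\}$. Then for $\nu$-almost every initial configuration $\omega$, conditioned on $\{\eta(0)\ge1\}$, for every $0<\varepsilon<1$, \[ (1-\varepsilon)\mathfrak{D}\subset\frac{\bar\xi_n}{n}\subset(1+\varepsilon)\mathfrak{D} \] for all $n$ large enough, $\mathbf{P}_\omega$-almost surely.
   Context: Frog model: given an initial configuration $\omega\in\{0,1,2,\dots\}^{\mathbb{Z}^d}$, site $x$ initially holds $\omega(x)$ particles. For each $x\in\mathbb{Z}^d$ and $1\le k\le\omega(x)$ let $(S^x_{n,k})_{n\ge0}$ be independent discrete-time simple random walks on $\mathbb{Z}^d$ with $S^x_{0,k}=x$; these are the trajectories the particles follow once activated. $\mathbf{P}_\omega$ denotes the law of these walks for fixed $\omega$. At time $0$ only the particles at the origin are active; whenever an active particle visits a site, all sleeping particles there become active. Formally, $t(x,z)=\min\{n: S^x_{n,k}=z\text{ for some }1\le k\le\omega(x)\}$ ($=\infty$ if none), $T(x,z)=\inf\sum_{i=1}^m t(x_{i-1},x_i)$ over all finite sequences $x=x_0,\dots,x_m=z$ in $\mathbb{Z}^d$, $\xi_n=\{y\in\mathbb{Z}^d:T(0,y)\le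 n\}$ and $\bar\xi_n=\bigcup_{y\in\xi_n}(y+(-1/2,1/2]^d)\subset\mathbb{R}^d$. *)

(* Defs.v *)
From HB Require Import structures.
From mathcomp Require Import all_boot all_order all_algebra.
From mathcomp Require Import all_classical all_reals all_analysis.
Set Implicit Arguments. Unset Strict Implicit. Unset Printing Implicit Defensive.
Import Order.TTheory GRing.Theory Num.Theory.
Local Open Scope classical_set_scope.
Local Open Scope ring_scope.

Definition site (d : nat) := 'rV[int]_d.

Definition discrete_rv d0 (Omega : measurableType d0) (V : Type)
  (X : Omega -> V) := forall B : set V, measurable (X @^-1` B).

Definition mutually_independent d0 (Omega : measurableType d0) (R : realType)
  (P : probability Omega R) (I V : eqType) (X : I -> Omega -> V) :=
  forall (F : seq I) (B : I -> set V), uniq F ->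
    P (\bigcap_(i in [set` F]) (X i @^-1` B i)) =
    (\prod_(i <- F) P (X i @^-1` B i))%E.

Definition unit_vec (d : nat) (i : 'I_d) : site d := \row_j (i == j)%:Z.
Definition is_unit_step (d : nat) (v : site d) :=
  exists i : 'I_d, v = unit_vec i \/ v = - unit_vec i.

(* xi x k j is the j-th step (j >= 0) of the walk of the k-th particle at x;
   the steps form an independent family, each uniform on the 2d unit vectors.
   Particles at x are indexed k = 0, ..., omega(x)-1 (paper: 1..omega(x)). *)
Definition iid_srw_steps d0 (Omega : measurableType d0) (R : realType)
  (Q : probability Omega R) (d : nat)
  (xi : site d -> nat -> nat -> Omega -> site d) :=
  (forall x k j, discrete_rv (xi x k j)) /\
  mutually_independent Q (fun p : site d * nat * nat => xi p.1.1 p.1.2 p.2) /\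
  (forall x k j (v : site d),
     Q (xi x k j @^-1` [set v]) =
     (if `[< is_unit_step v >] then ((2 * d)%:R^-1)%:E else 0%E)).

Definition walk (d : nat) (steps : site d -> nat -> nat -> site d)
  (x : site d) (k n : nat) : site d :=
  x + \sum_(j < n) steps x k j.

Section Frog.
Variables (R : realType) (d : nat).
Variable omega : site d -> nat.
Variable S : site d -> nat -> nat -> site d.

Definition tfrog (x z : site d) : \bar R :=
  ereal_inf [set (n%:R)%:E | n in [set n : nat |
     exists k, (k < omega x)%N /\ S x k n = z]].

Definition path_cost (x : site d) (s : seq (site d)) : \bar R :=
  (\sum_(i < size s) tfrog (nth x (x :: s) i) (nth x s i))%E.

Definition Tfrog (x z : site d) : \bar R :=
  ereal_inf [set path_cost x s | s in [set s : seq (site d) | last x s = z]].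

Definition xi_set (n : nat) : set (site d) :=
  [set y | (Tfrog (0%R : site d) y <= (n%:R)%:E)%E].

Definition int_to_real (y : site d) : 'rV[R]_d := \row_j ((y 0 j)%:~R).

Definition xi_bar (n : nat) : set 'rV[R]_d :=
  [set z | exists2 y, xi_set n y &
     forall j, (y 0 j)%:~R - 2^-1 < z 0 j /\ z 0 j <= (y 0 j)%:~R + 2^-1].
End Frog.

Definition l1_ball (R : realType) (d : nat) : set 'rV[R]_d :=
  [set z | \sum_(j < d) `|z 0 j| <= 1].
Definition scale_set (R : realType) (d : nat) (c : R) (A : set 'rV[R]_d) :=
  [set c *: a | a in A].

(* Main.v *)
(* The outer inclusion holds because walks move at l1-speed 1. For the inner
   one, call a site rich at scale j if it holds at least 2^(j 2^j) particles.
   Since delta < d, almost surely, for all large j, every box of side 2^j near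
   the origin contains a site rich at scale j, and a site rich at scale j,
   once activated, sends particles along a geodesic to every site within
   distance C 2^j. Hence from one activated rich site z the activation passes
   through rich sites at scales j, j+1, ..., reaching scale j at time O(2^j),
   and then travels at speed 1 in every direction; choosing 2^j of order
   epsilon n gives T(0,y) <= |y| + O(epsilon n).
   The first rich site is found by a walk started at the origin: by Fubini the
   trajectory can be frozen, and an unbounded nearest-neighbour trajectory
   visits every l1-sphere, hence so many distinct sites that almost surely it
   meets a site rich at scale j for all large j. *)
Require Import Defs.
From HB Require Import structures.
From mathcomp Require Import all_boot all_order all_algebra.
From mathcomp Require Import all_classical all_reals all_analysis.
From mathcomp Require Import zify ring lra.
Import Order.TTheory GRing.Theory Num.Theory.
Local Open Scope classical_set_scope.
Local Open Scope ring_scope.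
Set Implicit Arguments.
Unset Strict Implicit.
Unset Printing Implicit Defensive.

(** * The l1 norm on the lattice *)

Definition l1 (d : nat) (v : site d) : nat := (\sum_(i < d) `|v ord0 i|)%N.
Arguments l1 {d} v%_R.

Lemma l1_0 d : l1 (0 : site d) = 0%N.
Proof. by rewrite /l1 big1 // => i _; rewrite mxE. Qed.

Lemma l1N d (v : site d) : l1 (- v) = l1 v.
Proof. by apply: eq_bigr => i _; rewrite mxE abszN. Qed.

Lemma l1D d (u v : site d) : (l1 (u + v) <= l1 u + l1 v)%N.
Proof.
rewrite /l1 -big_split; apply: leq_sum => i _; rewrite mxE /=.
move: (u _ _) (v _ _) => a b; lia.
Qed.

Lemma l1B d (u v : site d) : (l1 (u - v) <= l1 u + l1 v)%N.
Proof. by rewrite -(l1N v); exact: l1D. Qed.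

Lemma l1_unit_step d (v : site d) : is_unit_step v -> l1 v = 1%N.
Proof.
have l1u i : l1 (unit_vec i : site d) = 1%N.
  rewrite /l1 (bigD1 i) //= big1 ?mxE ?eqxx // => j ji.
  by rewrite mxE eq_sym (negbTE ji).
by move=> [i [->|->]]; rewrite ?l1N l1u.
Qed.

(** A unit step along any nonzero coordinate, taken towards 0, lowers the norm by exactly one. The
    resulting geodesic word is the itinerary later prescribed to a particle. *)
Lemma unit_step_word d (v : site d) : exists s : seq (site d),
  [/\ size s = l1 v, forall u, u \in s -> is_unit_step u & \sum_(u <- s) u = v].
Proof.
have [n] := ubnP (l1 v); elim: n v => // n IH v; rewrite ltnS => vn.
have [v0|vN0] := eqVneq v 0.
  by exists [::]; rewrite v0 l1_0 big_nil; split.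
have [i vi] : exists i, v 0 i != 0.
  apply/existsP; apply: contraNT vN0; rewrite negb_exists => /forallP h.
  by apply/eqP/rowP => i; rewrite mxE; apply/eqP; have := h i; rewrite negbK.
pose e : site d := if 0 < v 0 i then unit_vec i else - unit_vec i.
have ue : is_unit_step e by exists i; rewrite /e; case: ifP => _; [left|right].
have hve : l1 v = (l1 (v - e)).+1.
  rewrite /l1 (bigD1 i) //= [in RHS](bigD1 i) //= -addSn; congr (_ + _)%N.
    rewrite !mxE /e; case: ifP => vi0; rewrite !mxE eqxx /=.
      by move: (v _ _) vi0 vi => a; lia.
    by move: (v _ _) vi0 vi => a; lia.
  apply: eq_bigr => j; rewrite eq_sym => /negbTE nij; rewrite !mxE /e.
  by case: ifP => _; rewrite !mxE nij ?oppr0 subr0.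
have [s [ss su sv]] := IH (v - e) ltac:(by rewrite -ltnS -hve).
exists (e :: s); split; first by rewrite /= ss hve.
  by move=> u; rewrite inE => /predU1P [->//|/su].
by rewrite big_cons sv addrC subrK.
Qed.

(** * Passage times and the unit speed bound *)

Section Passage.
Variables (R : realType) (d : nat) (omega : site d -> nat).
Variable S : site d -> nat -> nat -> site d.

Lemma tfrog_le (x z : site d) k n :
  (k < omega x)%N -> S x k n = z -> (tfrog R omega S x z <= n%:R%:E)%E.
Proof. by move=> kx Sz; apply: ereal_inf_lbound => /=; exists n => //; exists k. Qed.

Lemma path_cost_rcons (x : site d) s z :
  path_cost R omega S x (rcons s z) =
  (path_cost R omega S x s + tfrog R omega S (last x s) z)%E.
Proof.
rewrite /path_cost size_rcons big_ord_recr /=; congr (_ + _)%E.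
  apply: eq_bigr => i _.
  by rewrite -rcons_cons !nth_rcons /= ltnS (ltnW (ltn_ord i)) ltn_ord.
rewrite -rcons_cons !nth_rcons /= ltnSn ltnn eqxx; congr tfrog.
exact: (nth_last x (x :: s)).
Qed.

(* [reachable n y] is a version of T(0,y) <= n in which the infimum is attained. *)
Definition reachable (n : nat) (y : site d) := exists2 s : seq (site d),
  last 0 s = y & (path_cost R omega S 0%R s <= n%:R%:E)%E.

Lemma reachable0 : reachable 0 0.
Proof. by exists [::] => //; rewrite /path_cost big_ord0. Qed.

Lemma reachable_step n m x y k : reachable n x ->
  (k < omega x)%N -> S x k m = y -> reachable (n + m) y.
Proof.
move=> [s sx hs] kx Sy; exists (rcons s y); first by rewrite last_rcons.
by rewrite path_cost_rcons natrD EFinD leeD // sx (tfrog_le kx).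
Qed.

Lemma reachable_le n m y : reachable n y -> (n <= m)%N -> reachable m y.
Proof.
move=> [s sy hs] nm; exists s => //.
by apply: (le_trans hs); rewrite lee_fin ler_nat.
Qed.

Lemma reachable_xi_set n y : reachable n y -> xi_set R omega S n y.
Proof.
move=> [s sy hs]; rewrite /xi_set /Tfrog /=.
by apply: le_trans hs; apply: ereal_inf_lbound => /=; exists s.
Qed.

Hypothesis S_l1 : forall x k n, (l1 (S x k n - x)%R <= n)%N.

Lemma l1_le_tfrog x z : ((l1 (z - x))%:R%:E <= tfrog R omega S x z)%E.
Proof.
apply: le_ereal_inf_tmp => _ [n [k [_ <-]] <-].
by rewrite lee_fin ler_nat.
Qed.

Lemma l1_le_path_cost x s :
  ((l1 (last x s - x))%:R%:E <= path_cost R omega S x s)%E.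
Proof.
elim/last_ind: s => [|s z IH].
  by rewrite subrr l1_0 /path_cost big_ord0.
rewrite path_cost_rcons last_rcons.
apply: le_trans (leeD IH (l1_le_tfrog _ _)).
rewrite -EFinD lee_fin -natrD ler_nat.
have -> : z - x = (last x s - x) + (z - last x s) by rewrite [RHS]addrC subrKA.
exact: l1D.
Qed.

Lemma xi_set_l1 n y : xi_set R omega S n y -> (l1 y <= n)%N.
Proof.
rewrite /xi_set /= -(ler_nat R) -lee_fin; apply: le_trans.
apply: le_ereal_inf_tmp => _ [s sy <-].
by have := l1_le_path_cost 0 s; rewrite sy subr0.
Qed.

End Passage.

(** * Deterministic growth through rich sites *)

Section Growth.
Variables (R : realType) (d : nat) (omega : site d -> nat).
Variable S : site d -> nat -> nat -> site d.
(** [N] and [rad] will be [threshold] and [radius d]. The hypotheses [dense], [cover] and [hit]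
    isolate what holds almost surely, so that the growth argument itself is deterministic. *)
Variables (N rad : nat -> nat).
Hypothesis d_gt0 : (0 < d)%N.
Hypothesis rad_homo : {homo rad : i j / (i <= j)%N}.
Hypothesis omega0 : (1 <= omega 0%R)%N.
Hypothesis dense : exists J, forall j, (J <= j)%N -> forall z, (l1 z <= rad j)%N ->
  exists2 x, (l1 (x - z) <= d * 2 ^ j)%N & (N j <= omega x)%N.
Hypothesis cover : exists J, forall j, (J <= j)%N -> forall x y,
  (l1 x <= rad j + d * 2 ^ j)%N -> (N j <= omega x)%N ->
  (4 * d * l1 (y - x) <= j * 2 ^ j)%N ->
  exists2 k, (k < omega x)%N & S x k (l1 (y - x)) = y.
Hypothesis hit : forall J, exists j n, [/\ (J <= j)%N,
  (l1 (S 0%R 0 n) <= rad j)%N & (N j <= omega (S 0%R 0 n))%N].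

Let reach := reachable R omega S.

Lemma reachable_cover j n x y J :
  (forall j, (J <= j)%N -> forall x y,
  (l1 x <= rad j + d * 2 ^ j)%N -> (N j <= omega x)%N ->
  (4 * d * l1 (y - x) <= j * 2 ^ j)%N ->
  exists2 k, (k < omega x)%N & S x k (l1 (y - x)) = y) ->
  (J <= j)%N -> (l1 x <= rad j + d * 2 ^ j)%N -> (N j <= omega x)%N ->
  (4 * d * l1 (y - x) <= j * 2 ^ j)%N ->
  reach n x -> reach (n + l1 (y - x)) y.
Proof.
move=> cv Jj xj Nx yx rx.
by have [k kx Sy] := cv _ Jj _ _ xj Nx yx; exact: reachable_step rx kx Sy.
Qed.

(* From a first rich site [z], rich sites at doubling distances are reached
   one after the other; the total cost is a geometric sum. *)
Lemma reachable_linear : exists C J, forall j y, (J <= j)%N ->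
  (4 * d * (l1 y + C + d * 2 ^ j) <= j * 2 ^ j)%N ->
  reach (l1 y + C + 4 * d * 2 ^ j) y.
Proof.
have [J1 hJ1] := dense; have [J2 hJ2] := cover.
(* Consecutive rich sites are at distance at most 3d 2^j, so [cover] applies between them once 4d *
   3d <= j; hence the term 12 d^2. *)
have [j0 [n0 []]] := hit (J1 + J2 + 12 * d * d).
set z := S _ _ _ => j0J zr Nz.
have rz : reach n0 z.
  by apply: (@reachable_step _ _ _ _ 0 n0 0%R _ 0) => //; exact: reachable0.
(* The hop from scale j to j+1 costs at most 3d 2^j, and 3d 2^j + 3d 2^j = 3d 2^(j+1) preserves the
   bound. *)
have chain j : (j0 <= j)%N -> exists x, [/\ (l1 (x - z) <= d * 2 ^ j)%N,
    (N j <= omega x)%N & reach (n0 + 3 * d * 2 ^ j) x].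
  have base : exists x, [/\ (l1 (x - z) <= d * 2 ^ j0)%N,
      (N j0 <= omega x)%N & reach (n0 + 3 * d * 2 ^ j0) x].
    exists z; rewrite subrr l1_0; split=> //.
    by apply: (reachable_le rz); rewrite leq_addr.
  elim: j => [|j IH].
    by rewrite leqn0 => /eqP j00; move: base; rewrite j00.
  rewrite leq_eqVlt => /predU1P[j0j|]; first by move: base; rewrite j0j.
  rewrite ltnS => j0j; have [x [xz Nx rx]] := IH j0j.
  have [y yz Ny] : exists2 y, (l1 (y - z) <= d * 2 ^ j.+1)%N & (N j.+1 <= omega y)%N.
    apply: hJ1; first by lia.
    by apply: (leq_trans zr); apply: rad_homo; lia.
  have yx : (l1 (y - x) <= 3 * d * 2 ^ j)%N.
    have -> : y - x = (y - z) - (x - z) by rewrite opprB addrA subrK.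
    by apply: leq_trans (l1B _ _) _; rewrite expnS in yz; lia.
  exists y; split => //.
  have := reachable_cover hJ2 (_ : J2 <= j)%N (_ : l1 x <= _)%N Nx
    (_ : 4 * d * l1 (y - x) <= _)%N rx.
  have -> : x = (x - z) + z by rewrite subrK.
  have xr : (l1 (x - z + z)%R <= rad j + d * 2 ^ j)%N.
    apply: leq_trans (l1D _ _) _; rewrite addnC leq_add //.
    exact: (leq_trans zr (rad_homo j0j)).
  rewrite subrK in xr *.
  have dj : (4 * d * l1 (y - x) <= j * 2 ^ j)%N.
    apply: (@leq_trans (12 * d * d * 2 ^ j)).
      by have := leq_mul (leqnn (4 * d)) yx; lia.
    by rewrite leq_mul2r; apply/orP; right; lia.
    by move=> /(_ ltac:(lia) xr dj) /reachable_le; apply; rewrite expnS; lia.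
(* The last walk, from [x] to [y], costs at most |y| + |z| + d 2^j; with the chain cost this gives
   the coefficient 3d + d = 4d. *)
exists (n0 + l1 z)%N, j0 => j y j0j hy.
have [x [xz Nx rx]] := chain j j0j.
have yx : (l1 (y - x) <= l1 y + l1 z + d * 2 ^ j)%N.
  have -> : y - x = y - z - (x - z) by rewrite opprB addrA subrK.
  by have := l1B (y - z) (x - z); have := l1B y z; lia.
have xr : (l1 x <= rad j + d * 2 ^ j)%N.
  have -> : x = (x - z) + z by rewrite subrK.
  apply: leq_trans (l1D _ _) _; rewrite addnC leq_add //.
  exact: (leq_trans zr (rad_homo j0j)).
have dj : (4 * d * l1 (y - x) <= j * 2 ^ j)%N.
  by apply: (leq_trans _ hy); rewrite leq_mul2l; apply/orP; right; lia.
have J2j : (J2 <= j)%N by lia.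
apply: (reachable_le (reachable_cover hJ2 J2j xr Nx dj rx)).
move: (l1 _) (l1 _) (l1 _) (2 ^ j)%N yx => a b c e yx; nia.
Qed.

(** Here 1/K plays the role of epsilon and the extra K d allows for rounding to the lattice. The
    slack n/K has to pay for d, C and 4d 2^j. *)
Lemma xi_set_inner K : (0 < K)%N -> exists n0, forall n y, (n0 <= n)%N ->
  (K * l1 y + n <= K * n + K * d)%N -> xi_set R omega S n y.
Proof.
move=> K0; have [C [J hC]] := reachable_linear.
(* With M 2^j <= n < M 2^(j+1), the cost 4d 2^j is at most n/(4K), while 12 d n <= 24 d M 2^j <= j
   2^j as soon as j >= 24 d M. *)
pose M := (16 * d * K)%N; have M0 : (0 < M)%N by rewrite /M; lia.
pose J' := (J + 24 * d * M)%N.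
exists (M * 2 ^ J' + M + 2 * K * (C + d))%N => n y hn hy.
have nM : (0 < n %/ M)%N by rewrite divn_gt0 //; lia.
have /andP[] := trunc_log_bounds (isT : 1 < 2)%N nM.
set j := trunc_log _ _ => jn nj.
have jn' : (M * 2 ^ j <= n)%N by rewrite mulnC -leq_divRL.
have nj' : (n < M * (2 * 2 ^ j))%N by rewrite -expnS mulnC -ltn_divLR.
have Jj : (J' <= j)%N.
  rewrite /j; apply: trunc_log_max => //; rewrite leq_divRL //; lia.
have Mj := leq_mul (_ : 24 * d * M <= j)%N (leqnn (2 ^ j)).
have {}Mj : (24 * d * M * 2 ^ j <= j * 2 ^ j)%N by apply: Mj; rewrite /J' in Jj; lia.
have yn : (l1 y <= n + d)%N by rewrite -(leq_pmul2l K0) mulnDr; lia.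
have KC : (C + d <= n)%N.
  have : (1 * (C + d) <= 2 * K * (C + d))%N by rewrite leq_mul2r; lia.
  lia.
have dn : (d * 2 ^ j <= n)%N.
  apply: (leq_trans _ jn'); rewrite leq_mul2r; apply/orP; right; rewrite /M.
  rewrite -[leqLHS]muln1; have : (d * 1 <= 16 * d * K)%N by rewrite leq_mul //; lia.
  by [].
apply: reachable_xi_set.
apply: (@reachable_le _ _ _ _ (l1 y + C + 4 * d * 2 ^ j)).
  apply: hC; first by rewrite /J' in Jj; lia.
  apply: (leq_trans _ Mj).
  apply: (@leq_trans (4 * d * (3 * n))); first by rewrite leq_mul2l; lia.
  have := leq_mul (leqnn (12 * d)) (ltnW nj'); lia.
rewrite -(leq_pmul2l K0) !mulnDr.
have : (K * (4 * d * 2 ^ j) * 4 <= n)%N by rewrite /M in jn'; lia.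
lia.
Qed.

End Growth.

(** * From lattice sites to the rescaled shape *)

Lemma l1_natr (R : realType) d (y : site d) :
  (l1 y)%:R = \sum_(j < d) `|(y 0 j)%:~R| :> R.
Proof.
rewrite /l1 natr_sum; apply: eq_bigr => i _.
by rewrite -intr_norm pmulrn -abszE.
Qed.

(** A point and the centre of its unit cell differ by at most d in l1 norm, which is at most epsilon
    n once n >= K d with 1/K < epsilon. *)
Lemma xi_bar_shape (R : realType) d (omega : site d -> nat)
    (S : site d -> nat -> nat -> site d) :
  (forall n y, xi_set R omega S n y -> (l1 y <= n)%N) ->
  (forall K, (0 < K)%N -> exists n0, forall n y, (n0 <= n)%N ->
     (K * l1 y + n <= K * n + K * d)%N -> xi_set R omega S n y) ->
  forall eps : R, 0 < eps < 1 -> exists n0 : nat, forall n : nat, (n0 <= n)%N ->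
    scale_set (1 - eps) (@l1_ball R d) `<=`
      scale_set (n%:R^-1) (@xi_bar R d omega S n) /\
    scale_set (n%:R^-1) (@xi_bar R d omega S n) `<=`
      scale_set (1 + eps) (@l1_ball R d).
Proof.
move=> outer inner eps /andP[eps0 eps1].
have [K Keps] : exists K : nat, 1 < eps * K%:R.
  exists (Num.bound eps^-1).
  by rewrite -ltr_pdivrMl // mulr1 archi_boundP // invr_ge0 ltW.
have K0 : (0 < K)%N by move: Keps; case: (K) => //; rewrite mulr0 ltr10.
have [n0 hn0] := inner K K0.
exists (n0 + K * d + 1)%N => n hn.
have n_gt0 : 0 < n%:R :> R by rewrite ltr0n; lia.
have sum_half : \sum_(j < d) (1 : R) = d%:R by rewrite sumr_const card_ord.
have nKd : (K * d)%:R <= n%:R :> R by rewrite ler_nat; lia.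
split.
- move=> _ [a /= ha <-].
  pose w j : R := n%:R * ((1 - eps) * a ord0 j).
  (* This rounding matches the half-open cells: it is the integer with y - 1/2 < w <= y + 1/2. *)
  pose y : site d := \row_j Num.ceil (w j - 2^-1).
  have yj j : (y 0 j)%:~R - 2^-1 < w j /\ w j <= (y 0 j)%:~R + 2^-1.
    rewrite !mxE; have := ceil_itv (w j - 2^-1); rewrite intrD => /andP[].
    by lra.
  have sw : \sum_(j < d) `|w j| <= n%:R * (1 - eps).
    under eq_bigr => j _ do rewrite /w mulrA normrM.
    rewrite -mulr_sumr ger0_norm; last by apply: mulr_ge0; lra.
    by apply: ler_piMr => //; apply: mulr_ge0; lra.
  exists (n%:R *: ((1 - eps) *: a)); last first.
    by rewrite [LHS]scalerA mulVf ?scale1r // gt_eqF.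
  exists y; last by move=> j; rewrite !mxE; have := yj j; rewrite mxE.
  apply: hn0; first by lia.
  have hy : (l1 y)%:R <= n%:R * (1 - eps) + d%:R :> R.
    rewrite l1_natr -sum_half; apply: le_trans (lerD sw (lexx _)).
    rewrite -big_split; apply: ler_sum => j _ /=.
    have [h1 h2] := yj j.
    have -> : (y 0 j)%:~R = w j + ((y 0 j)%:~R - w j) by ring.
    apply: le_trans (ler_normD _ _) _; rewrite lerD2l ler_norml.
    by apply/andP; split; lra.
  rewrite -(ler_nat R) !natrD !natrM.
  have : K%:R * (l1 y)%:R <= K%:R * (n%:R * (1 - eps) + d%:R) :> R.
    by rewrite ler_wpM2l.
  have : n%:R <= n%:R * (eps * K%:R) by rewrite ler_peMr // ltW.
  nra.
- move=> _ [z [y hy yz] <-].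
  have yn := outer _ _ hy.
  have sz : \sum_(j < d) `|z ord0 j| <= n%:R * (1 + eps).
    apply: (@le_trans _ _ ((l1 y)%:R + d%:R)).
      rewrite l1_natr -sum_half -big_split; apply: ler_sum => j _ /=.
      have [h1 h2] := yz j.
      have -> : z ord0 j = (y 0 j)%:~R + (z ord0 j - (y 0 j)%:~R) by ring.
      apply: le_trans (ler_normD _ _) _; rewrite lerD2l ler_norml.
      by apply/andP; split; lra.
    rewrite mulrDr mulr1 lerD ?ler_nat //.
    rewrite natrM in nKd.
    have : d%:R <= d%:R * (eps * K%:R) by rewrite ler_peMr // ltW.
    have : eps * (K%:R * d%:R) <= eps * n%:R by rewrite ler_wpM2l // ltW.
    nra.
  have e1 : 0 < 1 + eps by lra.
  exists ((1 + eps)^-1 *: (n%:R^-1 *: z)); last first.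
    by rewrite [LHS]scalerA divff ?scale1r // gt_eqF.
  rewrite /l1_ball /= scalerA.
  under eq_bigr => j _ do rewrite mxE normrM.
  rewrite -mulr_sumr ger0_norm; last by rewrite mulr_ge0 // invr_ge0 ltW.
  rewrite -invfM mulrC ler_pdivrMr ?mulr_gt0 // mul1r.
  by rewrite mulrC in sz.
Qed.

(** * Independent cylinder events *)

Section Independence.
Variables (d0 : measure_display) (Omega : measurableType d0) (R : realType).
Variables (P : probability Omega R) (I V : eqType) (X : I -> Omega -> V).
Hypothesis X_rv : forall i, discrete_rv (X i).
Hypothesis X_indep : mutually_independent P X.
Variable B : I -> set V.

Definition cylinder (F : seq I) := \bigcap_(i in [set` F]) (X i @^-1` B i).

Lemma cylinder_cat F G : cylinder (F ++ G) = cylinder F `&` cylinder G.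
Proof.
apply/seteqP; split=> [w h|w [h1 h2] i /=].
  by split=> i iF; apply: h; rewrite /= mem_cat iF ?orbT.
by rewrite mem_cat => /orP[/h1|/h2].
Qed.

Lemma cylinder_nil : cylinder [::] = setT.
Proof. by apply/seteqP; split. Qed.

Lemma measurable_cylinder F : measurable (cylinder F).
Proof.
elim: F => [|i F IH]; first by rewrite cylinder_nil; exact: measurableT.
rewrite -cat1s cylinder_cat; apply: measurableI => //.
have -> : cylinder [:: i] = X i @^-1` B i.
  apply/seteqP; split=> [w h|w h j /=]; first by apply: h; rewrite /= mem_head.
  by rewrite inE => /eqP ->.
exact: X_rv.
Qed.

Lemma probability_cylinder F : uniq F ->
  P (cylinder F) = (\prod_(i <- F) P (X i @^-1` B i))%E.
Proof. exact: X_indep. Qed.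

Definition avoids (Gs : seq (seq I)) := \big[setI/setT]_(G <- Gs) ~` cylinder G.

Lemma avoids_cons G Gs : avoids (G :: Gs) = ~` cylinder G `&` avoids Gs.
Proof. by rewrite /avoids big_cons. Qed.

Lemma avoidsP Gs w : avoids Gs w <-> forall G, G \in Gs -> ~ cylinder G w.
Proof.
elim: Gs => [|G Gs IH]; first by rewrite /avoids big_nil; split.
rewrite avoids_cons; split=> [[h1 /IH h2] H|h].
  by rewrite inE => /predU1P[->|/h2].
split; first by apply: h; rewrite mem_head.
by apply/IH => H HG; apply: h; rewrite inE HG orbT.
Qed.

Lemma measurable_avoids Gs : measurable (avoids Gs).
Proof.
elim: Gs => [|G Gs IH]; first by rewrite /avoids big_nil; exact: measurableT.
rewrite avoids_cons; apply: measurableI => //; apply: measurableC.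
exact: measurable_cylinder.
Qed.

(* Induction on [Gs], for all [F] at once: removing [cylinder G] from
   [cylinder F] subtracts [cylinder (F ++ G)], again a cylinder. *)
Lemma probability_cylinder_avoids F Gs : uniq (F ++ flatten Gs) ->
  fine (P (cylinder F `&` avoids Gs)) =
  fine (P (cylinder F)) * \prod_(G <- Gs) (1 - fine (P (cylinder G))).
Proof.
have fin A : measurable A -> P A \is a fin_num by move=> mA; exact: fin_num_measure.
have mC := measurable_cylinder; have mA := measurable_avoids.
elim: Gs F => [|G Gs IH] F; first by rewrite /avoids !big_nil setIT mulr1.
move=> /= uFG; rewrite big_cons avoids_cons.
have uF : uniq (F ++ flatten Gs).
  apply: subseq_uniq uFG; rewrite subseq_cat2l; exact: suffix_subseq.
have uFG' : uniq ((F ++ G) ++ flatten Gs) by rewrite -catA.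
have uFG2 : uniq (F ++ G) by move: uFG'; rewrite cat_uniq => /and3P[].
have /and3P[uF1 _ uG] : [&& uniq F, ~~ has (mem F) G & uniq G] by rewrite -cat_uniq.
have split_G : P (cylinder F `&` avoids Gs) =
    (P (cylinder F `&` (~` cylinder G `&` avoids Gs)) +
     P (cylinder (F ++ G) `&` avoids Gs))%E.
  rewrite (measureDI P (measurableI _ _ (mC F) (mA Gs)) (mC G)).
  congr (P _ + P _)%E; first by rewrite setDE setIAC setIA.
  by rewrite cylinder_cat setIAC.
have /eqP := congr1 fine split_G.
rewrite fineD ?fin //; try by do ?[apply: measurableI => //]; apply: measurableC.
rewrite !IH // => /eqP e.
rewrite -[LHS](addrK (fine (P (cylinder (F ++ G))) *
  \prod_(G0 <- Gs) (1 - fine (P (cylinder G0))))) -e.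
have -> : fine (P (cylinder (F ++ G))) = fine (P (cylinder F)) * fine (P (cylinder G)).
  by rewrite -fineM ?fin // !probability_cylinder // big_cat.
by ring.
Qed.

(** Cylinders over disjoint index lists are independent, and each factor 1 - p is at most exp(-p) <=
    exp(-q). *)
Lemma probability_avoids_le (q : R) Gs : uniq (flatten Gs) ->
  (forall G, G \in Gs -> (q%:E <= P (cylinder G))%E) ->
  (P (avoids Gs) <= (expR (- (q * (size Gs)%:R)))%:E)%E.
Proof.
move=> uGs hq.
have fin A : measurable A -> P A \is a fin_num by move=> mA; exact: fin_num_measure.
rewrite -(fineK (fin _ (measurable_avoids _))) lee_fin.
have := @probability_cylinder_avoids [::] Gs uGs.
rewrite cylinder_nil setTI probability_setT mul1r => ->.
elim: Gs hq {uGs} => [|G Gs IH] hq; first by rewrite big_nil mulr0 oppr0 expR0.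
rewrite big_cons [size _]/= -natr1 mulrDr mulr1 opprD [in leRHS]addrC expRD.
have qG : q <= fine (P (cylinder G)).
  rewrite -lee_fin fineK ?fin //; last exact: measurable_cylinder.
  by apply: hq; rewrite mem_head.
apply: ler_pM.
- rewrite subr_ge0 -lee_fin fineK ?fin //; last exact: measurable_cylinder.
  exact: (probability_le1 _ (measurable_cylinder _)).
- apply: prodr_ge0 => H _.
  rewrite subr_ge0 -lee_fin fineK ?fin //; last exact: measurable_cylinder.
  exact: (probability_le1 _ (measurable_cylinder _)).
- by apply: le_trans (expR_ge1Dx _); rewrite lerD2l lerN2.
- by apply: IH => H HG; apply: hq; rewrite inE HG orbT.
Qed.

End Independence.

(** * Union bounds, Borel-Cantelli and Fubini *)

Section UnionBounds.
Variables (d0 : measure_display) (Omega : measurableType d0) (R : realType).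
Variable P : probability Omega R.

Lemma probability_bigsetU_le (T : eqType) (s : seq T) (A : T -> set Omega) (c : R) :
  (forall i, i \in s -> measurable (A i)) ->
  (forall i, i \in s -> (P (A i) <= c%:E)%E) ->
  measurable (\big[setU/set0]_(i <- s) A i) /\
  (P (\big[setU/set0]_(i <- s) A i) <= ((size s)%:R * c)%:E)%E.
Proof.
elim: s => [|i s IH] mA hA; first by rewrite big_nil measure0 mul0r.
have [||mU hU] := IH; first by move=> j js; apply: mA; rewrite inE js orbT.
  by move=> j js; apply: hA; rewrite inE js orbT.
rewrite big_cons [size _]/=; split.
  by apply: measurableU => //; apply: mA; rewrite mem_head.
apply: le_trans (measureU2 _ _ mU) _; first by apply: mA; rewrite mem_head.
by rewrite -addn1 natrD mulrDl mul1r addrC EFinD leeD // hA ?mem_head.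
Qed.

(** Borel-Cantelli for geometric tails. Applied to a constant sequence it shows that a single event
    is null. *)
Lemma ae_eventually (F : nat -> set Omega) : (forall j, measurable (F j)) ->
  (exists J, forall j, (J <= j)%N -> (P (F j) <= (2^-1 ^+ j)%:E)%E) ->
  {ae P, forall w, exists J, forall j, (J <= j)%N -> ~ F j w}.
Proof.
(* Emptying the events below [J], where no bound is available, leaves the limsup unchanged. *)
move=> mF [J hJ]; pose G j := if (J <= j)%N then F j else set0.
have mG j : measurable (G j) by rewrite /G; case: ifP.
have sumG : (\sum_(0 <= j <oo) P (G j) < +oo)%E.
  apply: (@le_lt_trans _ _ (\sum_(0 <= j <oo) (2^-1 ^+ j : R)%:E)%E).
    apply: lee_nneseries => // j _; rewrite /G; case: ifP => [/hJ//|_].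
    by rewrite measure0 lee_fin exprn_ge0 // invr_ge0.
  apply: (@le_lt_trans _ _ 2%:E); last exact: ltry.
  (* With epsilon = 2 the terms epsilon / 2^(j+1) are exactly 2^(-j). *)
  apply: le_trans (epsilon_trick0 xpredT (ler0n R 2)).
  apply: lee_nneseries => j _; first by rewrite lee_fin exprn_ge0 // invr_ge0.
  by rewrite lee_fin natrX exprS invfM mulrA divff // mul1r exprVn.
have := lim_sup_set_cvg0 mG sumG.
move=> G0; exists (lim_sup_set G); split => //.
  apply: bigcap_measurable => // n _; exact: bigcup_measurable.
move=> w /= h k _.
have /existsNP[j /not_implyP[hj /contrapT Fj]] :
  ~ forall j, (J + k <= j)%N -> ~ F j w by move=> H; apply: h; exists (J + k)%N.
by exists j => /=; [lia|rewrite /G ifT //; lia].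
Qed.

End UnionBounds.

Lemma ae_forall_countType (d0 : measure_display) (Omega : measurableType d0)
    (R : realType) (P : {measure set Omega -> \bar R}) (T : countType)
    (A : T -> Omega -> Prop) :
  (forall t, {ae P, forall w, A t w}) -> {ae P, forall w, forall t, A t w}.
Proof.
move=> hA.
have h n : {ae P, forall w, if unpickle n is Some t then A t w else True}.
  by case: (unpickle n) => [t|]; [exact: hA|exact: nearW].
have := ae_foralln h; apply: filterS => w hw t.
by have := hw (pickle t); rewrite pickleK.
Qed.

(** By Tonelli the two iterated integrals of the indicator of [E] agree; one vanishes, so the
    nonnegative integrand of the other vanishes almost everywhere. *)
Lemma ae_ysection_xsection (d1 d2 : measure_display) (Omega1 : measurableType d1)
    (Omega2 : measurableType d2) (R : realType) (P : probability Omega1 R)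
    (Q : probability Omega2 R) (E : set (Omega1 * Omega2)) : measurable E ->
  {ae Q, forall w2, P (ysection E w2) = 0} ->
  {ae P, forall w1, Q (xsection E w1) = 0}.
Proof.
move=> mE hE.
have mP := measurable_fun_xsection Q mE.
have mQ := measurable_fun_ysection P mE.
have e := indic_fubini_tonelli P Q mE.
rewrite indic_fubini_tonelli_FE // indic_fubini_tonelli_GE // in e.
have e0 : (\int[Q]_w2 (P \o ysection E) w2 = 0)%E.
  rewrite (ae_eq_integral (cst 0%E)) ?integral0 //.
  by apply: filterS hE => w h _.
rewrite e0 in e.
have := (ae_eq_integral_abs P measurableT mP).1.
rewrite (eq_integral (Q \o xsection E)); last by move=> w _; rewrite gee0_abs.
move=> /(_ e); apply: filterS => w; exact.
Qed.

(** * Lattice boxes and scales *)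

Definition box d (z : site d) (m : nat) : seq (site d) :=
  [seq z + \row_i (f i : nat)%:Z | f : {ffun 'I_d -> 'I_m} <- enum {ffun 'I_d -> 'I_m}].

Lemma size_box d (z : site d) m : size (box z m) = (m ^ d)%N.
Proof. by rewrite size_map -cardE card_ffun !card_ord. Qed.

Lemma box_uniq d (z : site d) m : uniq (box z m).
Proof.
rewrite map_inj_uniq ?enum_uniq // => f g /addrI /rowP fg.
by apply/ffunP => i; have := fg i; rewrite !mxE => -[/val_inj].
Qed.

Lemma l1_box d (z x : site d) m : x \in box z m -> (l1 (x - z) <= d * m)%N.
Proof.
move=> /mapP[f _ ->]; rewrite addrC addKr /l1.
rewrite -[X in (_ <= X * _)%N](card_ord d) -sum_nat_const.
by apply: leq_sum => i _; rewrite mxE /= ltnW.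
Qed.

Definition cube d (r : nat) : seq (site d) := box (const_mx (- r%:Z)) (2 * r).+1.

Lemma mem_cube d (z : site d) r : (l1 z <= r)%N -> z \in cube d r.
Proof.
move=> zr; have zi i : (`|z ord0 i| <= r)%N.
  by apply: leq_trans zr; rewrite /l1 (bigD1 i) //= leq_addr.
apply/mapP; exists [ffun i => inord (absz (z ord0 i + r%:Z))]; first by rewrite mem_enum.
apply/rowP => i; rewrite !mxE ffunE.
by have := zi i; move: (z _ _) => a ha; rewrite inordK; lia.
Qed.

(* The exponent is superlinear in [2 ^ j], so that the particles of one site
   follow every word of length [C * 2 ^ j], while [ln (threshold j) ^ delta] is
   still negligible compared with the number [2 ^ (j d)] of sites of a box of
   side [2 ^ j]. *)
Definition threshold (j : nat) : nat := (2 ^ (j * 2 ^ j))%N.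
(** This is the volume of a box of side 2^j. As a norm bound it also makes an unbounded path meet
    that many distinct sites, one on each sphere of smaller radius. *)
Definition radius (d j : nat) : nat := (2 ^ (j * d))%N.

Lemma radius_homo d : {homo radius d : i j / (i <= j)%N}.
Proof. by move=> i j ij; rewrite leq_exp2l // leq_mul2r ij orbT. Qed.

Lemma leq_threshold j : (j <= threshold j)%N.
Proof.
apply: ltnW; apply: leq_trans (ltn_expl j (isT : 1 < 2)%N) _.
by rewrite leq_exp2l // leq_pmulr // expn_gt0.
Qed.

(** * Exponential and logarithmic estimates *)

Lemma expR1_ge2 (R : realType) : 2 <= expR 1 :> R.
Proof. by apply: le_trans (expR_ge1Dx _). Qed.

Lemma expRN_natr_le (R : realType) (n : nat) : expR (- n%:R) <= 2^-1 ^+ n :> R.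
Proof.
rewrite expRN exprVn lef_pV2 ?posrE ?expR_gt0 ?exprn_gt0 //.
rewrite -[n%:R]mulr1 expRM_natl; apply: lerXn2r; rewrite ?nnegrE ?expR_ge0 //.
exact: expR1_ge2.
Qed.

(** This is ln(1 + t) <= t at t = a x - 1; a small slope a makes ln negligible against a linear
    term. *)
Lemma ln_le_linear (R : realType) (a x : R) : 0 < a -> 0 < x ->
  ln x <= a * x - ln a.
Proof.
move=> a0 x0; rewrite lerBrDr -lnM ?posrE // [x * a]mulrC.
have ax0 : 0 < a * x by rewrite mulr_gt0.
have := @le_ln1Dx R (a * x - 1); rewrite (_ : 1 + (a * x - 1) = a * x); last by ring.
by move=> h; apply: le_trans (h _) _; lra.
Qed.

(* With [q = (ln (threshold j)) ^ (- delta)], the exponent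
   [radius d j * q] grows like [2 ^ (j (d - delta))] up to powers of [j],
   hence beats [K j] for every [K]. *)
Lemma expRN_radius_le (R : realType) d (delta : R) (K : nat) :
  0 < delta < d%:R -> exists J, forall j, (J <= j)%N ->
  expR (- (ln (threshold j)%:R `^ (- delta) * (radius d j)%:R)) <=
  2^-1 ^+ (K * j) :> R.
Proof.
move=> /andP[delta0 deltad].
pose l2 : R := ln 2.
have l2_gt0 : 0 < l2 by apply: ln_gt0; rewrite ltr1n.
have l2_le1 : l2 <= 1.
  have := @le_ln1Dx R 1; rewrite -(_ : 2 = 1 + 1) //; apply.
  by apply: lt_trans (ltr01); rewrite oppr_lt0.
pose c := (d%:R - delta) * l2.
have c0 : 0 < c by rewrite mulr_gt0 ?subr_gt0.
(* The slope satisfies (1 + delta) a = c/2, so that (1 + delta) ln j uses up half of c j; the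
   constants, gathered in [b], fit in the other half. *)
pose a := c / (2 * (1 + delta)).
have a0 : 0 < a by rewrite divr_gt0 // mulr_gt0 // addr_gt0.
pose b := (1 + delta) * - ln a + ln K.+1%:R.
have [J hJ] : exists J : nat, 2 * b / c < J%:R.
  exists (Num.bound `|2 * b / c|).
  exact: le_lt_trans (ler_norm _) (archi_boundP (normr_ge0 _)).
exists (J + 1)%N => j hj.
have j0 : 0 < j%:R :> R by rewrite ltr0n; lia.
have lnthr : ln (threshold j)%:R = j%:R * 2 ^+ j * l2 :> R.
  by rewrite /threshold natrX lnXn ?ltr0n // -[LHS]mulr_natl natrM natrX.
have lnthr0 : 0 < ln (threshold j)%:R :> R.
  by rewrite lnthr !mulr_gt0 ?exprn_gt0 // ltr0n.
apply: le_trans (expRN_natr_le R (K * j)).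
rewrite ler_expR lerN2.
have -> : (radius d j)%:R = expR (j%:R * d%:R * l2) :> R.
  by rewrite /radius natrX -natrM expRM_natl lnK // posrE ltr0n.
rewrite /powR gt_eqF // -expRD.
(* The boolean factor covers K = 0, where the exponential is still positive. *)
have -> : (K * j)%:R = expR (ln K%:R + ln j%:R) * (K != 0)%:R :> R.
  have [->|K0] := eqVneq K 0%N; first by rewrite mulr0 mul0n.
  by rewrite mulr1 expRD !lnK ?posrE ?ltr0n ?lt0n ?natrM //; lia.
apply: (@le_trans _ _ (expR (ln K.+1%:R + ln j%:R))).
  have [->|K0] := eqVneq K 0%N; first by rewrite mulr0 expR_ge0.
  rewrite mulr1 ler_expR lerD2r ler_ln ?posrE ?ltr0n ?lt0n // ler_nat //.
rewrite ler_expR.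
(* As ln 2 <= 1, ln (threshold j) = j 2^j ln 2 is at most j 2^j. *)
have lnln : ln (ln (threshold j)%:R) <= ln j%:R + j%:R * l2 :> R.
  have -> : ln j%:R + j%:R * l2 = ln (j%:R * 2 ^+ j) :> R.
    by rewrite lnM ?posrE ?exprn_gt0 // lnXn // mulr_natl.
  rewrite ler_ln ?posrE ?mulr_gt0 ?exprn_gt0 // lnthr.
  by rewrite ler_piMr // mulr_ge0 ?ler0n ?exprn_ge0.
have lnj := ln_le_linear a0 j0.
have jb : 2 * b <= c * j%:R.
  rewrite [c * _]mulrC -ler_pdivrMr //; apply: ltW; apply: lt_le_trans hJ _.
  by rewrite ler_nat; lia.
have ac : a * (1 + delta) * 2 = c.
  by rewrite /a; field; apply/eqP; lra.
have h1 : delta * ln (ln (threshold j)%:R) <= delta * (ln j%:R + j%:R * l2).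
  by rewrite ler_pM2l.
have h2 : (1 + delta) * ln j%:R <= (1 + delta) * (a * j%:R - ln a).
  by rewrite ler_pM2l // addr_gt0.
have h3 : a * (1 + delta) * 2 * j%:R = c * j%:R by rewrite ac.
rewrite /b in jb; rewrite /c in jb h3.
nra.
Qed.

Lemma flatten_map_seq1 (T U : Type) (f : T -> U) (s : seq T) :
  flatten [seq [:: f x] | x <- s] = map f s.
Proof. by elim: s => //= x s ->. Qed.

(** * Rich sites in the random environment *)

Section Environment.
Variables (R : realType) (d : nat) (delta : R).
Hypothesis delta_bounds : 0 < delta < d%:R.
Variables (d1 : measure_display) (Omega1 : measurableType d1).
Variables (P : probability Omega1 R) (eta : site d -> Omega1 -> nat).
Hypothesis eta_rv : forall x, discrete_rv (eta x).
Hypothesis eta_indep : mutually_independent P eta.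
Hypothesis eta_ident :
  forall x (B : set nat), P (eta x @^-1` B) = P (eta 0 @^-1` B).
Hypothesis htail : exists N0 : nat, forall n : nat, (N0 <= n)%N ->
  ((powR (ln n%:R) (- delta))%:E <= P (eta (0%R : site d) @^-1` [set m | (n <= m)%N]))%E.

Lemma dimension_gt0 : (0 < d)%N.
Proof.
by case/andP: delta_bounds => h1 h2; rewrite -(ltr0n R); exact: lt_trans h2.
Qed.

Definition poor j (s : seq (site d)) :=
  avoids eta (fun _ => [set m | (threshold j <= m)%N]) [seq [:: x] | x <- s].

Lemma poorP j s w :
  poor j s w <-> forall x, x \in s -> (eta x w < threshold j)%N.
Proof.
rewrite /poor avoidsP; split=> h.
  move=> x xs; rewrite ltnNge; apply/negP => hx.
  have /h : [:: x] \in [seq [:: x] | x <- s] by apply: map_f.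
  by apply => y; rewrite /= inE => /eqP ->.
move=> _ /mapP[x xs ->] /(_ x); rewrite /= mem_head => /(_ isT).
by rewrite leqNgt h.
Qed.

Lemma measurable_poor j s : measurable (poor j s).
Proof. exact: measurable_avoids. Qed.

(** Sites are independent and each is rich with probability at least (ln (threshold j))^(-delta).
    The free rate [K] leaves room for union bounds of size 2^(O(j)). *)
Lemma probability_poor_le K : exists J, forall j, (J <= j)%N -> forall s,
  uniq s -> size s = radius d j -> (P (poor j s) <= (2^-1 ^+ (K * j))%:E)%E.
Proof.
have [N0 hN0] := htail; have [J hJ] := expRN_radius_le K delta_bounds.
exists (J + N0)%N => j hj s us ss.
apply: (@le_trans _ _ (expR (- (ln (threshold j)%:R `^ (- delta) * (radius d j)%:R)))%:E);
  last by rewrite lee_fin hJ //; lia.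
rewrite -ss -(size_map (fun x => [:: x])); apply: probability_avoids_le => //.
  by rewrite flatten_map_seq1 map_id.
move=> _ /mapP[x _ ->]; rewrite (probability_cylinder eta_indep) // big_seq1.
by rewrite eta_ident; apply: hN0; have := leq_threshold j; lia.
Qed.

Lemma ae_dense : {ae P, forall w, exists J, forall j, (J <= j)%N ->
  forall z, (l1 z <= radius d j)%N ->
  exists2 x, (l1 (x - z) <= d * 2 ^ j)%N & (threshold j <= eta x w)%N}.
Proof.
pose F j := \big[setU/set0]_(z <- cube d (radius d j)) poor j (box z (2 ^ j)).
(* There are at most 2^(d (d + 2) j) corners [z]; the remaining + 1 in the rate leaves the summable
   2^(-j). *)
have [J hJ] := probability_poor_le (d * (d + 2) + 1).
have hF j : measurable (F j) /\
    ((J + 1 <= j)%N -> (P (F j) <= (2^-1 ^+ j)%:E)%E).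
  split.
    by apply: bigsetU_measurable => z _; exact: measurable_poor.
  move=> hj.
  have [||_ h] := @probability_bigsetU_le _ _ R P _ (cube d (radius d j))
    (fun z => poor j (box z (2 ^ j))) (2^-1 ^+ ((d * (d + 2) + 1) * j)).
  - by move=> z _; exact: measurable_poor.
  - move=> z _; apply: hJ; first by lia.
      exact: box_uniq.
    by rewrite size_box /radius expnM.
  apply: le_trans h _; rewrite lee_fin mulnDl mul1n exprD mulrA ler_piMl //.
  rewrite exprVn ler_pdivrMr ?exprn_gt0 // mul1r -natrX ler_nat.
  have -> : (d * (d + 2) * j = (d + 2) * j * d)%N by lia.
  rewrite size_box expnM leq_exp2r ?dimension_gt0 //.
  apply: (@leq_trans (2 ^ (j * d + 2))).
    by rewrite expnD /radius; have := expn_gt0 2 (j * d); lia.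
  by rewrite leq_exp2l //; lia.
apply: filterS (ae_eventually (fun j => (hF j).1) _); last first.
  by exists (J + 1)%N => j; exact: (hF j).2.
move=> w [J' hJ']; exists J' => j /hJ' Fj z zr.
apply: contrapT => nx; apply: Fj; rewrite /F -bigcup_seq.
exists z; first exact: mem_cube.
apply/poorP => x xz; rewrite ltnNge; apply/negP => hx.
by apply: nx; exists x => //; exact: l1_box.
Qed.

(** For a frozen path, one visit to each sphere gives [radius d j] distinct sites, which are all
    poor with probability at most 2^(-j). Failure at every scale from [J] on lies in each of these
    events, hence is null. *)
Lemma ae_path_hits (S : nat -> site d) :
  (forall r, exists n, l1 (S n) = r) -> forall J,
  {ae P, forall w, exists j n,
    [/\ (J <= j)%N, (l1 (S n) <= radius d j)%N & (threshold j <= eta (S n) w)%N]}.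
Proof.
move=> /choice[n hn] J.
pose path j := [seq S (n r) | r <- iota 0 (radius d j)].
have [J1 hJ1] := probability_poor_le 1.
pose E := \bigcap_j (if (J <= j)%N then poor j (path j) else setT).
have mE : measurable E.
  by apply: bigcapT_measurable => j; case: ifP => // _; exact: measurable_poor.
have hE j : (J + J1 <= j)%N -> (P E <= (2^-1 ^+ j)%:E)%E.
  move=> hj; apply: (@le_trans _ _ (P (poor j (path j)))).
    apply: le_measure; rewrite ?inE //; first exact: measurable_poor.
    by move=> w /(_ j I); rewrite ifT //; lia.
  have := hJ1 j; rewrite mul1n; apply; first by lia.
    rewrite map_inj_uniq ?iota_uniq // => r1 r2 /(congr1 (@l1 d)).
    by rewrite !hn.
  by rewrite size_map size_iota.
have := ae_eventually (fun _ => mE) (ex_intro _ _ hE).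
apply: filterS => w [J' /(_ J' (leqnn _)) nE].
apply: contrapT => nh; apply: nE => j _; case: ifP => // Jj.
apply/poorP => _ /mapP[r hr ->]; rewrite ltnNge; apply/negP => hx.
apply: nh; exists j, (n r); split => //.
by rewrite hn; move: hr; rewrite mem_iota => /andP[_ /ltnW].
Qed.
End Environment.

(** * Simple random walks *)

Section Walks.
Variables (R : realType) (d : nat).
Variables (d2 : measure_display) (Omega2 : measurableType d2).
Variables (Q : probability Omega2 R).
Variable steps : site d -> nat -> nat -> Omega2 -> site d.
Hypothesis d_gt0 : (0 < d)%N.
Hypothesis hsteps : iid_srw_steps Q steps.

Let W (w : Omega2) := walk (fun x k j => steps x k j w).
Let X (p : site d * nat * nat) := steps p.1.1 p.1.2 p.2.

Let X_rv p : discrete_rv (X p).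
Proof. exact: hsteps.1. Qed.

Let X_indep : mutually_independent Q X.
Proof. exact: hsteps.2.1. Qed.

Lemma ae_unit_steps : {ae Q, forall w, forall x k j, is_unit_step (steps x k j w)}.
Proof.
have h (p : site d * nat * nat * site d) :
    {ae Q, forall w, X p.1 w = p.2 -> is_unit_step p.2}.
  have [u|nu] := pselect (is_unit_step p.2); first exact: nearW.
  exists (X p.1 @^-1` [set p.2]); split; first exact: X_rv.
    by have := hsteps.2.2 p.1.1.1 p.1.1.2 p.1.2 p.2; rewrite asboolF.
  by move=> w /=; apply: contra_notP => h /h.
have := ae_forall_countType h; apply: filterS => w hw x k j.
exact: (hw (x, k, j, steps x k j w)).
Qed.

Lemma walkS w x k n : W w x k n.+1 = W w x k n + steps x k n w.
Proof. by rewrite /W /walk big_ord_recr addrA. Qed.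

Lemma walk_word w x k (s : seq (site d)) m :
  (forall i, (i < size s)%N -> steps x k (m + i) w = nth 0 s i) ->
  W w x k (m + size s) = W w x k m + \sum_(v <- s) v.
Proof.
elim/last_ind: s => [|s v IH] hs; first by rewrite addn0 big_nil addr0.
rewrite size_rcons addnS walkS IH; last first.
  by move=> i hi; rewrite hs ?size_rcons ?ltnS ?(ltnW hi) // nth_rcons hi.
rewrite hs ?size_rcons // nth_rcons ltnn eqxx -cats1 big_cat big_seq1.
by rewrite addrA.
Qed.

Lemma l1_walk w x k n : (forall x k j, is_unit_step (steps x k j w)) ->
  (l1 (W w x k n - x) <= n)%N.
Proof.
move=> hw; rewrite /W /walk addrC addKr.
elim: n => [|n IH]; first by rewrite big_ord0 l1_0.
rewrite big_ord_recr /= -(addn1 n) (leq_trans (l1D _ _)) //.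
by rewrite leq_add // (l1_unit_step (hw _ _ _)).
Qed.

Let window x k m n : seq (site d * nat * nat) := [seq (x, k, i) | i <- iota m n].

Let window_uniq x k m n : uniq (window x k m n).
Proof. by rewrite map_inj_uniq ?iota_uniq // => i j []. Qed.

Lemma probability_window B (e : nat -> site d) x k m n :
  (forall i, (m <= i < m + n)%N -> B (x, k, i) = [set e i]) ->
  (forall i, (m <= i < m + n)%N -> is_unit_step (e i)) ->
  Q (cylinder X B (window x k m n)) = ((2 * d)%:R^-1 ^+ n)%:E.
Proof.
move=> hB he; rewrite (probability_cylinder X_indep) // big_map.
rewrite (eq_big_seq (fun _ => ((2 * d)%:R^-1)%:E)).
  rewrite -[in RHS](size_iota m n).
  elim: (iota m n) => [|i s IH]; first by rewrite big_nil.
  by rewrite big_cons IH -EFinM exprS.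
move=> i; rewrite mem_iota => hi.
by rewrite hB // hsteps.2.2 asboolT //; exact: he.
Qed.

(** Cut the walk into disjoint blocks of 2r steps. Almost surely some block consists of 2r equal
    steps; its endpoints are 2r apart, so one of them is at distance at least r from the start. *)
Lemma ae_walk_unbounded x k :
  {ae Q, forall w, forall r, exists n, (r <= l1 (W w x k n - x))%N}.
Proof.
apply: ae_foralln => r.
pose e : site d := unit_vec (Ordinal d_gt0).
have ue : is_unit_step e by exists (Ordinal d_gt0); left.
pose L := (2 * r)%N.
pose q : R := (2 * d)%:R^-1 ^+ L.
have q0 : 0 < q by rewrite exprn_gt0 // invr_gt0 ltr0n muln_gt0.
pose B (_ : site d * nat * nat) : set (site d) := [set e].
pose Gs K := [seq window x k (b * L) L | b <- iota 0 K].
(* Consecutive blocks concatenate to one window, so the indices are distinct. *)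
have flatGs K : flatten (Gs K) = window x k 0 (K * L).
  elim: K => [|K IH]; first by rewrite mul0n.
  rewrite /Gs -addn1 iotaD map_cat flatten_cat -/(Gs K) IH /= cats0.
  by rewrite add0n mulnDl mul1n /window iotaD map_cat.
have hq K G : G \in Gs K -> (q%:E <= Q (cylinder X B G))%E.
  by move=> /mapP[b _ ->]; rewrite (@probability_window _ (fun=> e)).
have Qav K : (Q (avoids X B (Gs K)) <= (expR (- (q * K%:R)))%:E)%E.
  rewrite -{2}(size_iota 0 K) -(size_map (fun b => window x k (b * L) L)).
  apply: (probability_avoids_le X_rv X_indep); last exact: hq.
  by rewrite flatGs; exact: window_uniq.
pose E := \bigcap_K avoids X B (Gs K).
have mE : measurable E by apply: bigcapT_measurable => K; exact: measurable_avoids.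
have hE j : (0 <= j)%N -> (Q E <= (2^-1 ^+ j)%:E)%E.
  move=> _; pose K := Num.bound (j%:R / q).
  have hK : j%:R < q * K%:R.
    by rewrite mulrC -ltr_pdivrMr // archi_boundP // divr_ge0 // ltW.
  apply: (@le_trans _ _ (Q (avoids X B (Gs K)))).
    apply: le_measure; rewrite ?inE //; first exact: measurable_avoids.
    by move=> w /(_ K I).
  apply: le_trans (Qav K) _; rewrite lee_fin; apply: le_trans (expRN_natr_le R j).
  by rewrite ler_expR lerN2 ltW.
have := ae_eventually (fun _ => mE) (ex_intro _ 0%N hE).
apply: filterS => w [J /(_ J (leqnn _)) nE].
have [K [_ nav]] : exists K, True /\ ~ avoids X B (Gs K) w.
  by apply: contrapT => h; apply: nE => K _; apply: contrapT => nK; apply: h; exists K.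
have [G [/mapP[b _ ->] hG]] : exists G, G \in Gs K /\ cylinder X B G w.
  apply: contrapT => h; apply: nav; apply/avoidsP => G GK cG; apply: h.
  by exists G.
have hs i : (i < L)%N -> steps x k (b * L + i) w = e.
  move=> iL; apply: (hG (x, k, (b * L + i)%N)) => /=.
  by apply: map_f; rewrite mem_iota leq_addr ltn_add2l iL.
have := @walk_word w x k (nseq L e) (b * L); rewrite size_nseq => /(_ _) hW.
have {}hW : W w x k (b * L + L) = W w x k (b * L) + e *+ L.
  rewrite hW; first by rewrite big_nseq iter_addr addr0.
  by move=> i iL; rewrite hs // nth_nseq iL.
have l1eL : l1 (e *+ L) = L.
  rewrite /l1 (bigD1 (Ordinal d_gt0)) //= big1.
    by rewrite mulmxnE mxE eqxx addn0 -mulr_natl mulr1 natz absz_nat.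
  by move=> j jd; rewrite mulmxnE mxE eq_sym (negbTE jd) mul0rn.
have := l1B (W w x k (b * L + L) - x) (W w x k (b * L) - x).
rewrite opprB addrA subrK hW [X in l1 X]addrC addKr l1eL /L => h.
have [h1|h1] := leqP r (l1 (W w x k (b * L) - x)); first by exists (b * L)%N.
exists (b * L + L)%N; rewrite hW; move: h h1.
set u := l1 _; set v := l1 _ => h h1; lia.
Qed.

(** At the first time the norm is at least r it equals r, since a step raises it by at most one. *)
Lemma walk_visits_spheres w : (forall x k j, is_unit_step (steps x k j w)) ->
  (forall r, exists n, (r <= l1 (W w 0%R 0 n - 0))%N) ->
  forall r, exists n, l1 (W w 0%R 0 n) = r.
Proof.
move=> hw hu r.
have [n hn nmin] := ex_minnP (hu r); rewrite subr0 in hn.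
exists n; apply/eqP; rewrite eqn_leq hn andbT.
case: n hn nmin => [|n] hn nmin.
  by rewrite /W /walk big_ord0 addr0 l1_0.
rewrite walkS (leq_trans (l1D _ _)) // (l1_unit_step (hw _ _ _)) addn1 ltnNge.
by apply/negP => hr; have := nmin n; rewrite subr0 ltnn => /(_ hr).
Qed.

Lemma discrete_rv_walk x k n : discrete_rv (fun w => W w x k n).
Proof.
elim: n => [|n IH] B.
  have -> : (fun w => W w x k 0) = cst x.
    by apply/funext => w; rewrite /W /walk big_ord0 addr0.
  by rewrite preimage_cst; case: ifP.
have -> : (fun w => W w x k n.+1) @^-1` B = \bigcup_v
    ((fun w => W w x k n) @^-1` [set v] `&` steps x k n @^-1` [set u | B (v + u)]).
  apply/seteqP; split=> w; rewrite /preimage /= walkS.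
    by exists (W w x k n).
  by move=> [v _ [<-]].
apply: countable_bigcupT_measurable => [|v]; first exact: countableP.
by apply: measurableI; [exact: IH|exact: hsteps.1].
Qed.

(** A particle follows a fixed geodesic word to x + v with probability (2d)^(-|v|), which the
    condition on |v| keeps above threshold^(-1/2). Among [threshold j] independent particles the
    mean number of successes is thus at least the square root of the threshold. *)
Lemma probability_miss (j : nat) (x v : site d) : (0 < j)%N ->
  exists A : set Omega2, [/\ measurable A,
    (4 * d * l1 v <= j * 2 ^ j)%N -> (Q A <= (2^-1 ^+ (j * 2 ^ j.-1))%:E)%E &
    forall w, (forall k, (k < threshold j)%N -> W w x k (l1 v) <> x + v) -> A w].
Proof.
move=> j0; have [s [ss su sv]] := unit_step_word v.
pose B (p : site d * nat * nat) := [set nth 0 s p.2].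
pose Gs := [seq window x k 0 (l1 v) | k <- iota 0 (threshold j)].
exists (avoids X B Gs); split; first exact: measurable_avoids.
  (* Half the exponent of the threshold: threshold j = 2^e * 2^e. *)
  move=> hv; pose e := (j * 2 ^ j.-1)%N.
  have e2 : (j * 2 ^ j = 2 * e)%N.
    by rewrite /e mulnCA -expnS prednK.
  have q_ge : (2 ^ e)%:R <= (2 * d)%:R^-1 ^+ l1 v * (threshold j)%:R :> R.
    rewrite exprVn mulrC ler_pdivlMr ?exprn_gt0 ?ltr0n ?muln_gt0 ?d_gt0 //.
    have -> : threshold j = (2 ^ e * 2 ^ e)%N by rewrite /threshold e2 -expnD addnn mul2n.
    rewrite -natrX -natrM ler_nat leq_mul2l.
    apply/orP; right.
    apply: (@leq_trans ((2 ^ (2 * d)) ^ l1 v)).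
      have [->|v0] := posnP (l1 v); first by rewrite !expn0.
      by rewrite leq_exp2r //; apply: ltnW; exact: ltn_expl.
    by rewrite -expnM leq_exp2l //; lia.
  apply: (@le_trans _ _
      (expR (- ((2 * d)%:R^-1 ^+ l1 v * (threshold j)%:R)))%:E).
    have -> : threshold j = size Gs by rewrite size_map size_iota.
    apply: (probability_avoids_le X_rv X_indep).
      have /(_ (iota 0 (threshold j))) h : forall ks, uniq ks ->
          uniq (flatten [seq window x k 0 (l1 v) | k <- ks]).
        elim=> // k ks IH /= /andP[kks uks]; rewrite cat_uniq window_uniq IH //.
        rewrite andbT /=; apply/hasPn => p /flattenP[_ /mapP[k' k'ks ->]].
        move=> /mapP[i _ ->]; apply/negP => /mapP[i' _ [kk' _]].
        by rewrite kk' in k'ks; rewrite k'ks in kks.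
      by apply: h; exact: iota_uniq.
    move=> _ /mapP[k _ ->]; rewrite (@probability_window _ (nth 0 s)) //.
    by move=> i; rewrite add0n => hi; apply: su; apply: mem_nth; rewrite ss.
  (* The bound exp(-2^e) is weakened to 2^(-2^e), then to 2^(-e). *)
  rewrite lee_fin; apply: (@le_trans _ _ (expR (- (2 ^ e)%:R))).
    by rewrite ler_expR lerN2.
  apply: le_trans (expRN_natr_le _ _) _; rewrite !exprVn lef_pV2 ?posrE ?exprn_gt0 //.
  by rewrite ler_eXn2l ?ltr1n //; apply: ltnW; exact: ltn_expl.
move=> w hw; apply/avoidsP => _ /mapP[k hk ->] hG.
apply: (hw k); first by move: hk; rewrite mem_iota.
have := @walk_word w x k s 0; rewrite add0n ss sv => -> //.
  by rewrite /W /walk big_ord0 addr0.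
move=> i hi; rewrite add0n; apply: (hG (x, k, i)).
by apply: map_f; rewrite mem_iota.
Qed.

(** A union bound over 2^(O(j)) pairs of a start and a displacement, against 2^(-j 2^(j-1)). The bad
    events concern the first [threshold j] particles only, hence do not depend on [omega]. *)
Lemma ae_cover (omega : site d -> nat) : {ae Q, forall w, exists J,
  forall j, (J <= j)%N -> forall x y, (l1 x <= radius d j + d * 2 ^ j)%N ->
  (threshold j <= omega x)%N -> (4 * d * l1 (y - x) <= j * 2 ^ j)%N ->
  exists2 k, (k < omega x)%N & W w x k (l1 (y - x)) = y}.
Proof.
have /choice[A hA] (p : nat * site d * site d) : exists A : set Omega2,
    [/\ measurable A, (0 < p.1.1)%N -> (4 * d * l1 p.2 <= p.1.1 * 2 ^ p.1.1)%N ->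
      (Q A <= (2^-1 ^+ (p.1.1 * 2 ^ p.1.1.-1))%:E)%E &
    forall w, (0 < p.1.1)%N -> (forall k, (k < threshold p.1.1)%N ->
      W w p.1.2 k (l1 p.2) <> p.1.2 + p.2) -> A w].
  have [j0|j0] := posnP p.1.1.
    by exists setT; split; rewrite ?j0 //; exact: measurableT.
  have [A [mA h1 h2]] := probability_miss p.1.2 p.2 j0.
  by exists A; split=> [//|_|w _]; [exact: h1|exact: h2].
pose near_steps j := [seq v <- cube d (j * 2 ^ j) | (4 * d * l1 v <= j * 2 ^ j)%N].
pose pairs j := [seq (j, x, v) | x <- cube d (radius d j + d * 2 ^ j), v <- near_steps j].
pose F j := \big[setU/set0]_(p <- pairs j) A p.
have pairsP j p : p \in pairs j ->
    p.1.1 = j /\ (4 * d * l1 p.2 <= p.1.1 * 2 ^ p.1.1)%N.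
  by move=> /allpairsP[[x v] [/= _ + ->]]; rewrite mem_filter => /andP[].
have mF j : measurable (F j).
  by apply: bigsetU_measurable => p _; case: (hA p).
(* The number of pairs times 2^j is at most 2^(j (d (d + 8) + 1)), and this lower bound on j gives d
   (d + 8) + 1 <= 2^(j-1). *)
have hF j : (d * (d + 8) + 2 <= j)%N -> (Q (F j) <= (2^-1 ^+ j)%:E)%E.
  move=> hj.
  have [||_ h] := @probability_bigsetU_le _ _ R Q _ (pairs j) A (2^-1 ^+ (j * 2 ^ j.-1)).
  - by move=> p _; case: (hA p).
  - move=> p /pairsP[pj hp]; have [_ h _] := hA p; rewrite -[in leRHS]pj; apply: h => //.
    by rewrite pj; lia.
  apply: le_trans h _; rewrite lee_fin !exprVn.
  rewrite ler_pdivrMr ?exprn_gt0 // ler_pdivlMl ?exprn_gt0 // -!natrX -natrM ler_nat.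
  have size_le : (size (pairs j) <= (2 ^ (j * d + j + 3)) ^ d * (2 ^ (2 * j + 2)) ^ d)%N.
    rewrite /pairs size_allpairs leq_mul //.
      rewrite size_box leq_exp2r // /radius !expnD.
      have hd : (d <= 2 ^ (j * d))%N.
        apply: ltnW; apply: leq_trans (ltn_expl d (isT : 1 < 2)%N) _.
        by rewrite leq_exp2l //; nia.
      have := leq_mul hd (leqnn (2 ^ j)).
      have := expn_gt0 2 j; have := expn_gt0 2 (j * d).
      by move: (2 ^ (j * d))%N (2 ^ j)%N => a b; nia.
    apply: leq_trans (_ : size (cube d (j * 2 ^ j)) <= _)%N.
      by rewrite size_filter count_size.
    rewrite size_box leq_exp2r // mul2n -addnn !expnD.
    have hj2 : (j <= 2 ^ j)%N by apply: ltnW; exact: ltn_expl.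
    have := leq_mul hj2 (leqnn (2 ^ j)); have := expn_gt0 2 j.
    by move: (2 ^ j)%N => a; nia.
  apply: leq_trans (leq_mul (leqnn _) size_le) _.
  rewrite -!expnM -!expnD leq_exp2l //.
  apply: (@leq_trans (j * (d * (d + 8) + 1))); first by nia.
  rewrite leq_mul2l; apply/orP; right.
  by apply: leq_trans (ltnW (ltn_expl _ (isT : 1 < 2)%N)) _; rewrite leq_exp2l //; lia.
have := ae_eventually mF (ex_intro _ _ hF).
apply: filterS => w [J hJ]; exists (J + 1)%N => j hj x y xr Nx yx.
apply: contrapT => nk; apply: (hJ j); first by lia.
rewrite /F -bigcup_seq; exists (j, x, y - x).
  apply: allpairs_f; first exact: mem_cube.
  rewrite mem_filter yx mem_cube //; apply: leq_trans yx.
  by rewrite leq_pmull // muln_gt0.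
have [_ _] := hA (j, x, y - x); apply => /=; first by lia.
move=> k kN Wk; apply: nk; exists k; first exact: leq_trans kN Nx.
by rewrite Wk addrC subrK.
Qed.

(** For almost every frozen walk, the hypothesis on deterministic paths holds for almost every
    environment; Tonelli exchanges the two quantifiers. *)
Lemma ae_walk_hits (d1 : measure_display) (Omega1 : measurableType d1)
    (P : probability Omega1 R) (eta : site d -> Omega1 -> nat) :
  (forall x, discrete_rv (eta x)) ->
  (forall S : nat -> site d, (forall r, exists n, l1 (S n) = r) -> forall J,
    {ae P, forall w, exists j n, [/\ (J <= j)%N, (l1 (S n) <= radius d j)%N &
      (threshold j <= eta (S n) w)%N]}) ->
  {ae P, forall w1, {ae Q, forall w2, forall J, exists j n, [/\ (J <= j)%N,
    (l1 (W w2 0%R 0 n) <= radius d j)%N &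
    (threshold j <= eta (W w2 0%R 0 n) w1)%N]}}.
Proof.
move=> eta_rv hits.
suff h J : {ae P, forall w1, {ae Q, forall w2, exists j n, [/\ (J <= j)%N,
    (l1 (W w2 0%R 0 n) <= radius d j)%N &
    (threshold j <= eta (W w2 0%R 0 n) w1)%N]}}.
  by have := ae_foralln h; apply: filterS => w1; exact: ae_foralln.
pose E := [set w : Omega1 * Omega2 | exists j n, [/\ (J <= j)%N,
    (l1 (W w.2 0%R 0 n) <= radius d j)%N &
    (threshold j <= eta (W w.2 0%R 0 n) w.1)%N]].
have mE : measurable E.
  (* Splitting over the scale, the time and the site visited writes [E] as a countable union of
     measurable rectangles. *)
  have -> : E = \bigcup_(p : nat * nat * site d)
      (if (J <= p.1.1)%N && (l1 p.2 <= radius d p.1.1)%N then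
        (eta p.2 @^-1` [set m | (threshold p.1.1 <= m)%N]) `*`
        ((fun w => W w 0%R 0 p.1.2) @^-1` [set p.2]) else set0).
    apply/seteqP; split=> [[w1 w2] /= [j [n [Jj Wr We]]]|[w1 w2] [[[j n] x] _] /=].
      by exists (j, n, W w2 0%R 0 n) => //=; rewrite Jj Wr.
    by case: ifP => // /andP[Jj xr] [/= hx Wx]; exists j, n; rewrite Wx.
  apply: countable_bigcupT_measurable => [|p]; first exact: countableP.
  case: ifP => _; last exact: measurable0.
  by apply: measurableX; [exact: eta_rv|exact: discrete_rv_walk].
have mEC : measurable (~` E) by exact: measurableC.
have : {ae P, forall w1, Q (xsection (~` E) w1) = 0}.
  apply: ae_ysection_xsection => //.
  apply: filterS2 ae_unit_steps (ae_walk_unbounded 0 0) => w2 unit_w2 unb_w2.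
  apply/negligibleP; first exact: measurable_ysection.
  have := hits _ (walk_visits_spheres unit_w2 unb_w2) J.
  by apply: negligibleS => w1 /ysectionP.
apply: filterS => w1 /negligibleP; have mx := measurable_xsection w1 mEC.
by move=> /(_ mx); apply: negligibleS => w2 nh; apply/xsectionP.
Qed.

End Walks.

(** * Assembly of the almost sure properties *)

Theorem theorem2 (R : realType) (d : nat) (hd : (0 < d)%N)
  (* the environment: i.i.d. eta(x), x in Z^d, on a probability space *)
  (d1 : measure_display) (Omega1 : measurableType d1)
  (P : probability Omega1 R) (eta : site d -> Omega1 -> nat)
  (eta_rv : forall x, discrete_rv (eta x))
  (eta_indep : mutually_independent P eta)
  (eta_ident : forall x (B : set nat),
     P (eta x @^-1` B) = P (eta 0 @^-1` B))
  (delta : R) (hdelta0 : 0 < delta) (hdeltad : delta < d%:R)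
  (htail : exists N0 : nat, forall n : nat, (N0 <= n)%N ->
     (((powR (ln n%:R) (- delta))%:E <= P (eta (0%R : site d) @^-1` [set m | (n <= m)%N]))%E))
  (* the walks: independent simple random walks, given by their steps *)
  (d2 : measure_display) (Omega2 : measurableType d2)
  (Q : probability Omega2 R) (steps : site d -> nat -> nat -> Omega2 -> site d)
  (hsteps : iid_srw_steps Q steps) :
  {ae P, forall w1 : Omega1, (1 <= eta (0%R : site d) w1)%N ->
    {ae Q, forall w2 : Omega2,
      forall eps : R, 0 < eps < 1 ->
      exists N : nat, forall n : nat, (N <= n)%N ->
        let xb := @xi_bar R d (eta^~ w1) (walk (fun x k j => steps x k j w2)) n in
        scale_set (1 - eps) (@l1_ball R d) `<=` scale_set (n%:R^-1) xb /\
        scale_set (n%:R^-1) xb `<=` scale_set (1 + eps) (@l1_ball R d)}}.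
Proof.
have delta_bounds : 0 < delta < d%:R by rewrite hdelta0.
have hits := ae_path_hits delta_bounds eta_rv eta_indep eta_ident htail.
have dense := ae_dense delta_bounds eta_rv eta_indep eta_ident htail.
apply: filterS2 dense (ae_walk_hits hd hsteps eta_rv hits) => w1 dense hit eta0.
have := ae_cover hd hsteps (eta^~ w1).
apply: filterS3 hit (ae_unit_steps hsteps) => w2 hit unit_w2 cover.
apply: xi_bar_shape.
  by move=> n y; apply: xi_set_l1 => x k m; exact: l1_walk.
move=> K K0.
exact: (xi_set_inner R hd (@radius_homo d) eta0 dense cover hit K0).
Qed.
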